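(* Let $(x_i,y_i)\in\mathbb{R}^2$, $i=1,\dots,n$, be $n$ paired independent and identically distributed data observations of a pair of random variables $(X,Y)$, and let $f_c>0$ be the cut-off frequency parameter. Let $\hat f_{XY}$, $\hat f_X$, $\hat f_Y$ be the band-limited maximum likelihood (BLML) estimators, with cut-off frequencies $[f_c,f_c]$, $f_c$ and $f_c$ respectively, of the joint pdf of $(X,Y)$ and of the marginal pdfs of $X$ and $Y$, computed from the samples $(x_i,y_i)$, $x_i$ and $y_i$ respectively. Then the estimator for mutual dependence $\hat d\triangleq d_h(\hat f_{XY},\hat f_X\hat f_Y)$ is given by $$\hat d = d_h(\hat f_{XY},\hat f_X\hat f_Y)=\sqrt{1-\frac{1}{n}\sum_{i=1}^n\frac{\hat c_i^{(XY)}}{\hat c_i^{(X)}\,\hat c_i^{(Y)}}},$$ where the vectors $\hat{\mathbf c}^{(XY)}=\{\hat c_i^{(XY)}\}_{i=1}^n$, $\hat{\mathbf c}^{(X)}=\{\hat c_i^{(X)}\}_{i=1}^n$, $\hat{\mathbf c}^{(Y)}=\{\hat c_i^{(Y)}\}_{i=1}^n$ are given by $$\hat{\mathbf c}^{(XY)}=\arg\max_{\boldsymbol\rho_n^{(XY)}(\mathbf c)=0}\ \prod_{i=1}^n\frac{1}{c_i^2},\qquad \rho_{ni}^{(XY)}(\mathbf c)\triangleq\sum_{j=1}^n c_j\,\frac{\sin(\pi f_c(x_i-x_j))}{\pi(x_i-x_j)}\,\frac{\sin(\pi f_c(y_i-y_j))}{\pi(y_i-y_j)}-\frac{n}{c_i},$$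 $$\hat{\mathbf c}^{(X)}=\arg\max_{\boldsymbol\rho_n^{(X)}(\mathbf c)=0}\ \prod_{i=1}^n\frac{1}{c_i^2},\qquad \rho_{ni}^{(X)}(\mathbf c)\triangleq\sum_{j=1}^n c_j\,\frac{\sin(\pi f_c(x_i-x_j))}{\pi(x_i-x_j)}-\frac{n}{c_i},$$ $$\hat{\mathbf c}^{(Y)}=\arg\max_{\boldsymbol\rho_n^{(Y)}(\mathbf c)=0}\ \prod_{i=1}^n\frac{1}{c_i^2},\qquad \rho_{ni}^{(Y)}(\mathbf c)\triangleq\sum_{j=1}^n c_j\,\frac{\sin(\pi f_c(y_i-y_j))}{\pi(y_i-y_j)}-\frac{n}{c_i}.$$
   Context: **Distance and mutual dependence.** For probability density functions $p,q$ on $\mathbb{R}^m$, the Bhattacharyya (Hellinger) distance $d_h$ is defined by $$d_h^2(p,q)\triangleq\frac12\int\left(\sqrt{p(\mathbf x)}-\sqrt{q(\mathbf x)}\right)^2\mathrm d\mathbf x .$$ The mutual dependence of random variables $X,Y$ with joint pdf $f_{XY}$ and marginal pdfs $f_X,f_Y$ is $d(X,Y)\triangleq d_h\big(f_{XY}(x,y),f_X(x)f_Y(y)\big)$. The estimator $\hat d$ is obtained by replacing the pdfs by their BLML estimators; $\hat f_X\hat f_Y$ denotes the function $(x,y)\mapsto\hat f_X(x)\hat f_Y(y)$ on $\mathbb{R}^2$. **BLML estimator.** Given $n$ independent samples $\mathbf x_1,\dots,\mathbf x_n\in\mathbb{R}^m$ of an unknown band-limited pdf and an assumed cut-off frequency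 vector $\mathbf f_c=(f_{c1},\dots,f_{cm})\in\mathbb{R}^m$, let $$\mathrm{sinc}_{\mathbf f_c}(\mathbf x)\triangleq\prod_{k=1}^m\frac{\sin(\pi f_{ck}x_k)}{\pi x_k},$$ where each factor $\frac{\sin(\pi f_{ck} t)}{\pi t}$ is understood as its limit $f_{ck}$ at $t=0$ (the same convention applies to all such quotients in the claim). The BLML estimator of the pdf is $$\hat f(\mathbf x)=\left(\frac1n\sum_{i=1}^n\hat c_i\,\mathrm{sinc}_{\mathbf f_c}(\mathbf x-\mathbf x_i)\right)^2,$$ where $\hat{\mathbf c}=[\hat c_1,\dots,\hat c_n]^T$ is $$\hat{\mathbf c}=\arg\max_{\boldsymbol\rho_n(\mathbf c)=0}\prod_{i=1}^n\frac1{c_i^2},\qquad \rho_{ni}(\mathbf c)\triangleq\sum_{j=1}^n c_j s_{ij}-\frac{n}{c_i},\quad s_{ij}\triangleq\mathrm{sinc}_{\mathbf f_c}(\mathbf x_i-\mathbf x_j).$$ Here $\boldsymbol\rho_n(\mathbf c)=(\rho_{n1}(\mathbf c),\dots,\rho_{nn}(\mathbf c))$, and the maximization is over vectors $\mathbf c\in\mathbb{R}^n$ (with nonzero entries) satisfying $\boldsymbol\rho_n(\mathbf c)=0$. The estimators $\hat f_{XY}$ ($m=2$), $\hat f_X$ and $\hat f_Y$ ($m=1$) are the instances of this construction with coefficient vectors $\hat{\mathbf c}^{(XY)},\hat{\mathbf c}^{(X)},\hat{\mathbf c}^{(Y)}$ respectively.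
   Formalization: As stated the formula fails (e.g. n=2, f_c=1, samples (0,0),(1,1)): band-limited roots change sign. It is proved with those roots in place of √f̂ in d_h, and for d_h itself when the product of the three roots is ≥0, which is exactly when it holds. *)

(* Defs.v *)
From HB Require Import structures.
From mathcomp Require Import all_boot all_order all_algebra.
From mathcomp Require Import all_classical all_reals all_analysis.

Set Implicit Arguments.
Unset Strict Implicit.
Unset Printing Implicit Defensive.

Import Order.TTheory GRing.Theory Num.Theory.
Import numFieldNormedType.Exports.

Local Open Scope classical_set_scope.
Local Open Scope ring_scope.

Definition sinc {R : realType} (fc t : R) : R :=
  if t == 0 then fc else sin (pi * fc * t) / (pi * t).

Definition sincv {R : realType} {m : nat} (fc v : 'rV[R]_m) : R :=
  \prod_(k < m) sinc (fc 0 k) (v 0 k).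

Definition scalar_pt {R : realType} (a : R) : 'rV[R]_1 := \row_(k < 1) a.

Definition pair_pt {R : realType} (a b : R) : 'rV[R]_2 :=
  \row_(k < 2) [:: a; b]`_k.

(* The set of all maximizers. The BLML maximizer is never unique: the
   constraint and the objective are both invariant under c |-> - c. *)
Definition argmax {R : realType} {T : Type} (D : set T) (F : T -> R) : set T :=
  [set c | D c /\ forall c', D c' -> F c' <= F c].

Definition rho {R : realType} {n : nat} (s : 'M[R]_n) (c : 'cV[R]_n)
    (i : 'I_n) : R :=
  \sum_(j < n) c j 0 * s i j - n%:R / c i 0.

Definition blml_feasible {R : realType} {n : nat} (s : 'M[R]_n) :
    set 'cV[R]_n :=
  [set c : 'cV[R]_n | (forall i, c i 0 != 0) /\ (forall i, rho s c i = 0)].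

Definition blml_argmax {R : realType} {n : nat} (s : 'M[R]_n) :
    set 'cV[R]_n :=
  argmax (blml_feasible s) (fun c : 'cV[R]_n => \prod_(i < n) (1 / c i 0 ^+ 2)).

Definition blml_coef {R : realType} {m n : nat} (fc : 'rV[R]_m)
    (xs : 'I_n -> 'rV[R]_m) : set 'cV[R]_n :=
  blml_argmax (\matrix_(i < n, j < n) sincv fc (xs i - xs j)).

(* The band-limited function whose square is the BLML estimate; it may be
   negative. *)
Definition blml_root {R : realType} {m n : nat} (fc : 'rV[R]_m)
    (xs : 'I_n -> 'rV[R]_m) (c : 'cV[R]_n) (v : 'rV[R]_m) : R :=
  1 / n%:R * \sum_(i < n) c i 0 * sincv fc (v - xs i).

Definition blml_pdf {R : realType} {m n : nat} (fc : 'rV[R]_m)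
    (xs : 'I_n -> 'rV[R]_m) (c : 'cV[R]_n) (v : 'rV[R]_m) : R :=
  blml_root fc xs c v ^+ 2.

(* The distance between the densities r^2 and s^2, computed with the given
   square roots r and s, which need not be nonnegative. For BLML estimates the
   band-limited roots and the nonnegative ones give different values: sinc
   series change sign. *)
Definition hellinger_roots {R : realType} {d : measure_display}
    {T : measurableType d} (mu : {measure set T -> \bar R}) (r s : T -> R) : \bar R :=
  sqrte ((1 / 2)%:E * \int[mu]_z ((r z - s z) ^+ 2)%:E)%E.

Definition hellinger {R : realType} {d : measure_display}
    {T : measurableType d} (mu : {measure set T -> \bar R}) (p q : T -> R) : \bar R :=
  hellinger_roots mu (fun z => Num.sqrt (p z)) (fun z => Num.sqrt (q z)).

Definition lebesgue2 {R : realType} :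
    {measure set (measurableTypeR R * measurableTypeR R) -> \bar R} :=
  (@lebesgue_measure R \x @lebesgue_measure R)%E.

(* Main.v *)
Require Import Defs.
From HB Require Import structures.
From mathcomp Require Import all_boot all_order all_algebra.
From mathcomp Require Import all_classical all_reals all_analysis.
From mathcomp Require Import measurable_realfun ring lra.

Set Implicit Arguments.
Unset Strict Implicit.
Unset Printing Implicit Defensive.

Import Order.TTheory GRing.Theory Num.Theory.
Import numFieldNormedType.Exports.
Local Open Scope classical_set_scope.
Local Open Scope ring_scope.

(** Shifted sinc functions satisfy [int sinc (t - a) sinc (t - b) dt = sinc (a - b)].
    Hence the constraint [rho c = 0] says precisely that the root
    [r = 1/n sum_j c_j k_j] of a BLML estimate satisfies [int k_i r = 1 / c_i];
    summing against [c_i / n] gives [int r^2 = 1], and summing the joint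
    coefficients against [1 / (cX_i cY_i)] gives the inner product of the joint
    root with the product of the marginal roots.

    The sinc identity is proved with absolutely convergent integrals only.
    Tonelli applied to [w e^(-wt) (1 - cos ut)] yields
    [int (1 - cos ut) / t^2 dt = pi u], hence [int phi_u phi_w = pi w] for
    [phi_u t = sin(ut) / t] and [0 <= w <= u].  Fubini applied to
    [phi_u(t) phi_w(t) sin(wd)] on [0 <= w <= u] then gives the integral of
    [phi_u(t) (phi_u(t - d) + phi_u(t + d))]. *)

(** * Calculus of absolutely convergent integrals with a known value *)

(** Integrability is bundled with the value so that sums, translates and products of known integrals
    need no separate side conditions. *)
Definition has_integral {d} {T : measurableType d} {R : realType}
    (mu : {measure set T -> \bar R}) (f : T -> R) (v : R) : Prop :=
  mu.-integrable setT (EFin \o f) /\ (\int[mu]_x (f x)%:E = v%:E)%E.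

Section has_integral.
Context {d : measure_display} {T : measurableType d} {R : realType}.
Variable mu : {measure set T -> \bar R}.
Implicit Types (f g : T -> R) (v w : R).

Lemma has_integral_ext f g v : f =1 g -> has_integral mu f v ->
  has_integral mu g v.
Proof. by move=> /funext ->. Qed.

Lemma has_integral_measurable f v : has_integral mu f v ->
  measurable_fun setT f.
Proof. by case=> /measurable_int/measurable_EFinP. Qed.

Lemma has_integralD f g v w : has_integral mu f v -> has_integral mu g w ->
  has_integral mu (fun x => f x + g x) (v + w).
Proof.
move=> [fi fv] [gi gw]; split.
  exact: (integrableD measurableT fi gi).
under eq_integral do rewrite EFinD.
by rewrite integralD// fv gw.
Qed.

Lemma has_integralZ k f v : has_integral mu f v ->
  has_integral mu (fun x => k * f x) (k * v).
Proof.
move=> [fi fv]; split.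
  exact: (integrableZl measurableT k fi).
under eq_integral do rewrite EFinM.
by rewrite integralZl// fv.
Qed.

Lemma has_integralB f g v w : has_integral mu f v -> has_integral mu g w ->
  has_integral mu (fun x => f x - g x) (v - w).
Proof.
move=> fv /(@has_integralZ (-1)); rewrite mulN1r => /(has_integralD fv).
by apply: has_integral_ext => x; rewrite mulN1r.
Qed.

Lemma has_integral0 : has_integral mu (fun=> 0) 0.
Proof.
split; last by rewrite integral0.
exact: integrable0.
Qed.

Lemma has_integral_sum (I : Type) (s : seq I) (F : I -> T -> R) (V : I -> R) :
  (forall i, has_integral mu (F i) (V i)) ->
  has_integral mu (fun x => \sum_(i <- s) F i x) (\sum_(i <- s) V i).
Proof.
move=> FV; elim: s => [|i s IHs].
  rewrite big_nil; apply: has_integral_ext has_integral0 => x.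
  by rewrite big_nil.
rewrite big_cons; apply: has_integral_ext (has_integralD (FV i) IHs).
by move=> x; rewrite big_cons.
Qed.

(** Measurability of [g] is a separate premise because equality almost everywhere need not transfer
    it. *)
Lemma has_integral_ae f g v : {ae mu, forall x, f x = g x} ->
  measurable_fun setT g -> has_integral mu f v -> has_integral mu g v.
Proof.
move=> fg mg [fi fv].
have fgE : ae_eq mu setT (EFin \o f) (EFin \o g).
  by apply: filterS fg => x /= -> _.
have mf := measurable_int _ fi.
have mg' : measurable_fun setT (EFin \o g) by exact/measurable_EFinP.
split; last by rewrite -fv; apply/esym/ae_eq_integral.
apply/integrableP; split => //.
move/integrableP: fi => [_].
rewrite (@ae_eq_integral _ _ _ mu setT (abse \o (EFin \o g)) (abse \o (EFin \o f)))//.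
- exact: measurableT_comp.
- exact: measurableT_comp.
- by apply: filterS fg => x /= -> _.
Qed.

Lemma ge0_has_integral f v : (forall x, 0 <= f x) -> measurable_fun setT f ->
  (\int[mu]_x (f x)%:E = v%:E)%E -> has_integral mu f v.
Proof.
move=> f0 mf fv; split => //; apply/integrableP; split; first exact/measurable_EFinP.
under eq_integral do rewrite /= ger0_norm//.
by rewrite fv ltry.
Qed.

Lemma le_integrable_fun f g v : measurable_fun setT f ->
  (forall x, `|f x| <= g x) -> has_integral mu g v ->
  mu.-integrable setT (EFin \o f).
Proof.
move=> mf fg [gi _]; apply: (le_integrable measurableT _ _ gi) => //.
  exact/measurable_EFinP.
move=> x _ /=; rewrite lee_fin; apply: le_trans (fg x) _; exact: ler_norm.
Qed.

Lemma integrable_has_integral f : mu.-integrable setT (EFin \o f) ->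
  has_integral mu f (fine (\int[mu]_x (f x)%:E)%E).
Proof. by move=> fi; split => //; rewrite fineK//; exact: integrable_fin_num. Qed.

Lemma has_integral_unique f v w : has_integral mu f v -> has_integral mu f w ->
  v = w.
Proof. by move=> [_ fv] [_]; rewrite fv => -[]. Qed.

(** The pushforward of [mu] under [h] agrees with [mu] on measurable sets, so this is the change of
    variables formula for a pushforward. *)
Lemma has_integral_comp (h : T -> T) f v : measurable_fun setT h ->
  (forall A, measurable A -> mu (h @^-1` A) = mu A) ->
  has_integral mu f v -> has_integral mu (f \o h) v.
Proof.
move=> mh hmu [fi fv].
have mf := measurable_int _ fi.
pose hm : {mfun _ >-> _} := HB.pack h (isMeasurableFun.Build _ _ _ _ _ mh).
have hE (g : T -> \bar R) :
    (\int[pushforward mu hm]_x g x = \int[mu]_x g x)%E.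
  by apply: eq_measure_integral => A mA _; exact: hmu.
have fhi : mu.-integrable setT ((EFin \o f) \o h).
  apply/integrableP; split; first exact: measurableT_comp.
  move/integrableP: fi => [_]; rewrite -(hE (abse \o (EFin \o f))).
  rewrite (ge0_integral_pushforward mh)//.
    exact: measurableT_comp.
  by move=> x _; exact: abse_ge0.
split; first by [].
by rewrite -fv -[RHS]hE (integral_pushforward mh (D := setT) mf).
Qed.

End has_integral.

(** * Lebesgue measure on the line: translation, reflection, null points *)

Section lebesgue_line.
Context {R : realType}.
Notation mu := (@lebesgue_measure R).

(** The measure transported by the translation agrees with Lebesgue measure on half-open intervals,
    and these determine it. *)
Lemma lebesgue_measure_shift (a : R) (A : set R) : measurable A ->
  mu ((fun x : R => x + a) @^-1` A) = mu A.
Proof.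
pose h : measurableTypeR R -> measurableTypeR R := fun x => x + a.
have mh : measurable_fun setT h by exact: measurable_funD.
pose hm : {mfun _ >-> _} := HB.pack h (isMeasurableFun.Build _ _ _ _ _ mh).
move=> mA; apply/esym/(@lebesgue_measure_unique R (pushforward mu hm)) => //=.
move=> _ [[b c]] _ <-.
rewrite /pushforward [X in _ = mu X](_ : _ = `]b - a, c - a]%classic); last first.
  by apply/seteqP; split => x /=; rewrite !in_itv/= /h ltrBlDr lerBrDr.
rewrite !lebesgue_measure_itv/= !lte_fin ltrD2r; case: ifPn => // _.
by rewrite -!EFinB; congr EFin; ring.
Qed.

Lemma has_integral_shift (a v : R) (f : R -> R) :
  has_integral mu f v -> has_integral mu (fun x => f (x + a)) v.
Proof.
apply: (@has_integral_comp _ _ _ mu (fun x => x + a)); first exact: measurable_funD.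
exact: lebesgue_measure_shift.
Qed.

Lemma has_integral_opp (v : R) (f : R -> R) :
  has_integral mu f v -> has_integral mu (fun x => f (- x)) v.
Proof.
apply: (@has_integral_comp _ _ _ mu -%R) => //.
exact: lebesgue_measureN.
Qed.

Lemma ae_neq (a : R) : {ae mu, forall t, t != a}.
Proof.
exists [set a]; split => //; first exact: lebesgue_measure_set1.
by move=> t /= /negP; rewrite negbK => /eqP.
Qed.

(** Inversion is continuous off the closed set [[set 0]]; the point [0], with default value [0], is
    handled apart. *)
Lemma measurable_fun_invr : measurable_fun setT (fun x : R => x^-1).
Proof.
rewrite -(setUv [set 0 : R]); apply/measurable_funU => //; first exact: measurableC.
split; first exact: measurable_fun_set1.
apply: open_continuous_measurable_fun.
  by apply: closed_openC; exact: closed_eq.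
move=> x; rewrite inE /= => /eqP x0; exact: inv_continuous.
Qed.

End lebesgue_line.

(** * Fubini for product measures *)

Section product_measure.
Context {d1 d2 : measure_display} {T1 : measurableType d1}
  {T2 : measurableType d2} {R : realType}.
Variables (m1 : {sigma_finite_measure set T1 -> \bar R})
  (m2 : {sigma_finite_measure set T2 -> \bar R}).

(** The two iterated integrals of [f] coincide, so an integral of [F] is computed through [G].
    Asking for [F] only almost everywhere leaves room for the points excluded in [pairf_int2]. *)
Lemma has_integral_fubini (f : T1 * T2 -> R) (F : T1 -> R) (G : T2 -> R) (v : R) :
  (m1 \x m2)%E.-integrable setT (EFin \o f) ->
  {ae m1, forall x, (\int[m2]_y (f (x, y))%:E = (F x)%:E)%E} ->
  measurable_fun setT F ->
  (forall y, \int[m1]_x (f (x, y))%:E = (G y)%:E)%E ->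
  (\int[m2]_y (G y)%:E = v%:E)%E ->
  has_integral m1 F v.
Proof.
move=> fi fF mF fG Gv.
have iF := integrable_fubini_F fi.
have FE : ae_eq m1 setT (fubini_F m2 (EFin \o f)) (EFin \o F).
  by apply: filterS fF => x /= + _.
have mF' : measurable_fun setT (EFin \o F) by exact/measurable_EFinP.
have mFf := measurable_int _ iF.
split.
  apply/integrableP; split => //; move/integrableP: iF => [_].
  rewrite (@ae_eq_integral _ _ _ m1 setT (abse \o (EFin \o F))
    (abse \o fubini_F m2 (EFin \o f)))//.
  - exact: measurableT_comp.
  - exact: measurableT_comp.
  - by apply: filterS fF => x /= + _; rewrite /fubini_F/= => ->.
rewrite -(ae_eq_integral (EFin \o F) (fubini_F m2 (EFin \o f)))//.
rewrite integral12_prod_meas1// -integral21_prod_meas1// -Gv.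
by apply: eq_integral => y _; rewrite -fG.
Qed.

(** Tonelli applied to the absolute values gives integrability; then the iterated integral
    factors. *)
Lemma has_integral_prod (f : T1 -> R) (g : T2 -> R) (v w : R) :
  has_integral m1 f v -> has_integral m2 g w ->
  has_integral (m1 \x m2)%E (fun z => f z.1 * g z.2) (v * w).
Proof.
move=> fv gw; have mf := has_integral_measurable fv.
have mg := has_integral_measurable gw.
have fgi : (m1 \x m2)%E.-integrable setT (EFin \o (fun z => f z.1 * g z.2)).
  apply/integrable12ltyP.
    apply/measurable_EFinP; apply: measurable_funM.
      exact: (measurableT_comp mf).
    exact: (measurableT_comp mg).
  have [_ fE] := integrable_has_integral (integrable_norm fv.1).
  have [_ gE] := integrable_has_integral (integrable_norm gw.1).
  set a := fine _ in fE; set b := fine _ in gE.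
  rewrite (_ : (fun x => _) = (fun x => `|f x|%:E * b%:E)%E); last first.
    apply/funext => x; rewrite -gE -ge0_integralZl//.
    - by apply: eq_integral => y _ /=; rewrite normrM EFinM.
    - by apply/measurable_EFinP; exact: measurableT_comp.
    - by move=> y _; rewrite lee_fin normr_ge0.
  rewrite ge0_integralZr//.
  - by rewrite fE -EFinM ltry.
  - by apply/measurable_EFinP; exact: measurableT_comp.
  - by rewrite -gE; apply: integral_ge0 => y _; rewrite lee_fin normr_ge0.
split => //; rewrite -integral12_prod_meas1//.
case: gw => gi gE; case: fv => fi fE.
rewrite mulrC EFinM -fE -integralZl//.
by apply: eq_integral => x _; rewrite /fubini_F/= -gE muleC -integralZl//.
Qed.

End product_measure.

(** * Laplace integrals on the half-line *)

Section laplace_integrals.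
Context {R : realType}.
Notation mu := (@lebesgue_measure R).

Lemma ge0_integral_itvoy (f F : R -> R) (l v : R) : l - F 0 = v ->
  (forall x, 0 <= x -> 0 <= f x) -> (forall x : R, is_derive x 1 F (f x)) ->
  continuous f -> F x @[x --> +oo] --> l ->
  (\int[mu]_(x in `]0%R, +oo[) (f x)%:E = v%:E)%E.
Proof.
move=> <- f0 dF cf Fl; rewrite integral_itv_obnd_cbnd; last first.
  by apply/measurable_EFinP/measurable_funTS; exact: continuous_measurable_fun.
rewrite (@ge0_continuous_FTC2y _ f F 0 l)//.
- exact: continuous_subspaceT.
- apply: cvg_at_right_filter; apply: differentiable_continuous.
  by apply/derivable1_diffP; have [] := dF 0.
- by move=> x _; rewrite derive1E; have [_ ->] := dF x.
Qed.

Lemma cvg0_le (f : R -> R) (c : R) : (forall x, 0 < x -> `|f x| <= c / x) ->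
  f x @[x --> +oo] --> 0.
Proof.
move=> fc; apply/cvgrPdist_le => e e0; near=> x.
have x0 : 0 < x by near: x; exact: nbhs_pinfty_gt.
rewrite sub0r normrN (le_trans (fc _ x0))// ler_pdivrMr// -ler_pdivrMl//.
Unshelve. all: by end_near. Qed.

Lemma expRN_le (a : R) : 0 < a -> expR (- a) <= a^-1.
Proof.
move=> a0; rewrite expRN lef_pV2 ?posrE ?expR_gt0//.
by apply: le_trans (expR_ge1Dx a); rewrite lerDr.
Qed.

(** This is [expRN_le] at [a / 2], squared; the quadratic decay absorbs the factor [w] in the
    primitive of [w * expR (- (w * t))]. *)
Lemma expRN_le2 (a : R) : 0 < a -> expR (- a) <= 4 / a ^+ 2.
Proof.
move=> a0; rewrite (_ : - a = - (a / 2) + - (a / 2)); last by field.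
have a20 : 0 < a / 2 by rewrite divr_gt0.
rewrite expRD (_ : 4 / a ^+ 2 = (a / 2)^-1 * (a / 2)^-1); last first.
  by field; rewrite gt_eqF.
by rewrite ler_pM ?expR_ge0 ?expRN_le.
Qed.

(** Writing [1 / t^2] as a superposition of exponentials lets Tonelli reduce the Fejer kernel to
    elementary integrals. The primitive comes from integration by parts. *)
Lemma integral_mul_expRN (t : R) : 0 < t ->
  (\int[mu]_(w in `]0%R, +oo[) (w * expR (- (w * t)))%:E = (t ^- 2)%:E)%E.
Proof.
move=> t0.
apply: (@ge0_integral_itvoy _ (fun w => - (w / t + t ^- 2) * expR (- (w * t))) 0).
- by rewrite !mul0r !add0r oppr0 expR0 mulr1 opprK.
- by move=> w w0; rewrite mulr_ge0 ?expR_ge0.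
- move=> w; apply: is_derive_eq.
  by rewrite /GRing.scale/=; field; rewrite gt_eqF.
- by move=> w; apply: differentiable_continuous; apply/derivable1_diffP.
- apply: (@cvg0_le _ (4 / t ^+ 3 + t ^- 2 / t)) => w w0.
  have wt0 : 0 < w * t by rewrite mulr_gt0.
  rewrite normrM normrN !ger0_norm ?expR_ge0//; last first.
    by rewrite addr_ge0// ?divr_ge0 ?ltW// invr_gt0 exprn_gt0.
  rewrite mulrDl [leRHS]mulrDl lerD//.
    rewrite (_ : 4 / t ^+ 3 / w = w / t * (4 / (w * t) ^+ 2)); last first.
      by field; rewrite !gt_eqF.
    by rewrite ler_wpM2l ?expRN_le2// divr_ge0// ltW.
  rewrite -mulrA -invfM [t * w]mulrC ler_wpM2l ?expRN_le//.
  by rewrite invr_ge0 exprn_ge0// ltW.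
Qed.

(** The value is [1 / w - w / (w^2 + u^2)], the difference of the Laplace transforms of [1] and of
    the cosine. *)
Lemma integral_expRN_subcos (u w : R) : 0 < w ->
  (\int[mu]_(t in `]0%R, +oo[) ((1 - cos (u * t)) * expR (- (w * t)))%:E =
   (u ^+ 2 / (w * (w ^+ 2 + u ^+ 2)))%:E)%E.
Proof.
move=> w0.
have D0 : 0 < w ^+ 2 + u ^+ 2 by rewrite ltr_pwDl ?exprn_gt0// sqr_ge0.
apply: (@ge0_integral_itvoy _ (fun t => expR (- (w * t)) *
  ((w * cos (u * t) - u * sin (u * t)) / (w ^+ 2 + u ^+ 2) - w^-1)) 0).
- rewrite !mulr0 oppr0 expR0 cos0 sin0.
  by field; rewrite !gt_eqF.
- by move=> t t0; rewrite mulr_ge0 ?expR_ge0// subr_ge0 cos_le1.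
- move=> t; apply: is_derive_eq.
  by rewrite /GRing.scale/=; field; rewrite !gt_eqF.
- by move=> t; apply: differentiable_continuous; apply/derivable1_diffP.
(* As sine and cosine are bounded by 1, [C] bounds the bracket of the primitive; [expRN_le] supplies
   the decay in [t]. *)
- pose C := (w + `|u|) / (w ^+ 2 + u ^+ 2) + w^-1.
  have C0 : 0 <= C.
    apply: addr_ge0; last by rewrite invr_ge0 ltW.
    by apply: divr_ge0 (ltW D0); rewrite addr_ge0 ?(ltW w0).
  apply: (@cvg0_le _ (w^-1 * C)) => t t0.
  have wt0 : 0 < w * t by rewrite mulr_gt0.
  rewrite normrM (ger0_norm (expR_ge0 _)) mulrAC -invfM.
  rewrite ler_pM ?expR_ge0 ?expRN_le//.
  rewrite (le_trans (ler_normB _ _))// /C lerD//; last first.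
    by rewrite ger0_norm// invr_ge0 ltW.
  rewrite normrM (@ger0_norm _ _^-1) ?invr_ge0 ?(ltW D0)//.
  rewrite ler_wpM2r ?invr_ge0 ?(ltW D0)// (le_trans (ler_normB _ _))//.
  rewrite !normrM (ger0_norm (ltW w0)) lerD//.
    by rewrite ler_piMr ?(ltW w0)// ler_norml cos_geN1 cos_le1.
  by rewrite ler_piMr// ler_norml sin_geN1 sin_le1.
Qed.

(** The integrand is [w] times the value in [integral_expRN_subcos]: what is left once [t] is
    integrated out in [integral_fejer_oy]. *)
Lemma integral_poisson (u : R) : 0 < u ->
  (\int[mu]_(w in `]0%R, +oo[) (u ^+ 2 / (w ^+ 2 + u ^+ 2))%:E =
   (u * (pi / 2))%:E)%E.
Proof.
move=> u0.
have D0 w : 0 < w ^+ 2 + u ^+ 2 by rewrite ltr_wpDl ?exprn_gt0// sqr_ge0.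
apply: (@ge0_integral_itvoy _ (fun w => u * atan (w / u)) (u * (pi / 2))).
- by rewrite mul0r atan0 mulr0 subr0.
- by move=> w _; rewrite divr_ge0 ?sqr_ge0 ?(ltW (D0 _)).
- move=> w; apply: is_derive_eq.
  rewrite /GRing.scale/=.
  have := D0 w; move: (w) => w' D; field; rewrite !gt_eqF//=.
- move=> w; apply: cvgM; first exact: cvg_cst.
  apply: cvgV; first by rewrite gt_eqF.
  have : {for w, continuous (fun w : R => w ^+ 2 + u ^+ 2)}.
    by apply: differentiable_continuous; apply/derivable1_diffP.
  exact.
- apply: cvgM; first exact: cvg_cst.
  apply: (cvg_comp _ _ _ (@cvgy_atan R)).
  by apply: gt0_cvgMly => //; rewrite invr_gt0.
Qed.

End laplace_integrals.

(** * The Fejer kernel and products of two sine quotients *)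

Section fejer_kernel.
Context {R : realType}.
Notation mu := (@lebesgue_measure R).

Lemma measurable_sinM {d} {T : measurableType d} (f g : T -> R) :
  measurable_fun setT f -> measurable_fun setT g ->
  measurable_fun setT (fun z => sin (f z * g z)).
Proof.
move=> mf mg; apply: (measurableT_comp (f := @sin R)); last exact: measurable_funM.
by apply: continuous_measurable_fun => x; exact: continuous_sin.
Qed.

Lemma measurable_cosM {d} {T : measurableType d} (f g : T -> R) :
  measurable_fun setT f -> measurable_fun setT g ->
  measurable_fun setT (fun z => cos (f z * g z)).
Proof.
move=> mf mg; apply: (measurableT_comp (f := @cos R)); last exact: measurable_funM.
by apply: continuous_measurable_fun => x; exact: continuous_cos.
Qed.

Lemma measurable_divr {d} {T : measurableType d} (f g : T -> R) :
  measurable_fun setT f -> measurable_fun setT g ->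
  measurable_fun setT (fun z => f z / g z).
Proof.
move=> mf mg; apply: measurable_funM => //.
exact: measurableT_comp measurable_fun_invr mg.
Qed.

Lemma derivable_measurable_EFin (f : R -> R) (D : set R) : measurable D ->
  (forall x : R, derivable f x 1) -> measurable_fun D (fun x => (f x)%:E).
Proof.
move=> mD df; apply/measurable_EFinP/measurable_funTS.
apply: continuous_measurable_fun => x; apply: differentiable_continuous.
exact/derivable1_diffP.
Qed.

Lemma measurable_fejer (u : R) :
  measurable_fun setT (fun t : R => (1 - cos (u * t)) / t ^+ 2).
Proof.
apply: measurable_divr; last exact: measurable_funX.
by apply: measurable_funB => //; apply: measurable_cosM.
Qed.

Lemma fejer_ge0 (u t : R) : 0 <= (1 - cos (u * t)) / t ^+ 2.
Proof. by rewrite divr_ge0 ?sqr_ge0// subr_ge0 cos_le1. Qed.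

Lemma integral_fejer_oy (u : R) : 0 < u ->
  (\int[mu]_(t in `]0%R, +oo[) ((1 - cos (u * t)) / t ^+ 2)%:E =
   (u * (pi / 2))%:E)%E.
Proof.
move=> u0.
pose D : set R := `]0, +oo[%classic.
have mD : measurable D by exact: measurable_itv.
have mDi : measurable_fun setT (\1_D : R -> R) by exact: measurable_indic.
have Dgt0 (t : R) : (t \in D) = (0 < t).
  by rewrite mem_setE in_itv/= andbT.
(* The two indicators make the integrand nonnegative on the whole plane, where Tonelli is
   applied. *)
pose h (z : R * R) : R :=
  (1 - cos (u * z.1)) * (z.2 * expR (- (z.2 * z.1))) * \1_D z.1 * \1_D z.2.
have h0 z : (0 <= (h z)%:E)%E.
  rewrite /h !indicE !Dgt0 lee_fin; case: ltP => z1; last by rewrite mulr0 mul0r.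
  case: ltP => z2; last by rewrite mulr0.
  by rewrite !mulr1 !mulr_ge0 ?expR_ge0 ?subr_ge0 ?cos_le1// ltW.
have mh : measurable_fun setT (fun z => (h z)%:E).
  apply/measurable_EFinP; apply: measurable_funM.
    apply: measurable_funM.
      apply: measurable_funM.
        by apply: measurable_funB => //; apply: measurable_cosM.
      apply: measurable_funM => //; apply: measurableT_comp => //.
      by apply: measurableT_comp => //; apply: measurable_funM.
    exact: (measurableT_comp mDi).
  exact: (measurableT_comp mDi).
have := @fubini_tonelli _ _ _ _ _ mu mu (fun z => (h z)%:E) mh h0.
(* Integrating out [w] for fixed [t > 0] produces the factor [1 / t^2]. *)
have -> : (fun x => \int[mu]_y (h (x, y))%:E)%E =
    (fun t : R => ((1 - cos (u * t)) / t ^+ 2)%:E) \_ D.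
  apply/funext => t; rewrite patchE Dgt0; case: ltP => t0; last first.
    by rewrite integral0_eq// => w _; rewrite /h/= indicE Dgt0 ltNge t0 mulr0 mul0r.
  rewrite EFinM -(integral_mul_expRN t0) -ge0_integralZl//; last 2 first.
  - exact: derivable_measurable_EFin.
  - by move=> w /=; rewrite in_itv/= andbT => w0; rewrite lee_fin mulr_ge0 ?expR_ge0 ?ltW.
  rewrite [RHS]integral_mkcond; apply: eq_integral => w _.
  rewrite patchE Dgt0 /h/= !indicE !Dgt0 t0 mulr1.
  by case: ifPn; rewrite ?mulr0 ?mulr1.
rewrite -integral_mkcond => ->.
(* In the other order, integrating out [t] for fixed [w > 0] must give the Poisson integrand. *)
rewrite -integral_poisson// [RHS]integral_mkcond; apply: eq_integral => w _.
rewrite patchE Dgt0; case: ltP => w0; last first.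
  by rewrite integral0_eq// => t _; rewrite /h/= !indicE !Dgt0 [0 < w]ltNge w0 mulr0.
rewrite (_ : u ^+ 2 / _ = w * (u ^+ 2 / (w * (w ^+ 2 + u ^+ 2)))); last first.
  by field; rewrite !gt_eqF// ltr_wpDl ?exprn_gt0// sqr_ge0.
rewrite EFinM -(integral_expRN_subcos u w0) -ge0_integralZl//; last 2 first.
- exact: derivable_measurable_EFin.
- by rewrite lee_fin ltW.
rewrite [RHS]integral_mkcond; apply: eq_integral => t _.
rewrite patchE Dgt0 /h/= !indicE !Dgt0 w0 mulr1.
by case: ifPn; rewrite ?mulr0 ?mulr1// => _; rewrite -EFinM mulrCA.
Qed.

Lemma has_integral_fejer (u : R) : 0 <= u ->
  has_integral mu (fun t => (1 - cos (u * t)) / t ^+ 2) (u * pi).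
Proof.
rewrite le_eqVlt => /predU1P[<-|u0].
  rewrite mul0r; apply: has_integral_ext (has_integral0 mu) => t.
  by rewrite mul0r cos0 subrr mul0r.
apply: ge0_has_integral; first by move=> t; exact: fejer_ge0.
  exact: measurable_fejer.
pose f (t : R) := ((1 - cos (u * t)) / t ^+ 2)%:E.
have mf : measurable_fun setT f by apply/measurable_EFinP; exact: measurable_fejer.
have f0 t : (0 <= f t)%E by rewrite lee_fin fejer_ge0.
have TE : [set: R] = `]-oo, 0%R] `|` `]0%R, +oo[.
  apply/seteqP; split => // t _ /=.
  by rewrite !in_itv/= andbT; case: (leP t 0); [left|right].
rewrite TE ge0_integral_setU//=; last 3 first.
- exact: (measurable_funTS mf).
- by move=> t _; exact: f0.
- rewrite disj_set2E; apply/eqP; rewrite -subset0 => t []/=.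
  by rewrite !in_itv/= andbT => /le_lt_trans /[apply]; rewrite ltxx.
rewrite integral_fejer_oy// (_ : u * pi = u * (pi / 2) + u * (pi / 2)); last by field.
rewrite EFinD; congr (_ + _)%E; rewrite -(integral_fejer_oy u0).
rewrite integral_itv_obnd_cbnd; last exact: (measurable_funTS mf).
(* Reflection exchanges the two half-lines, and the kernel is even. *)
rewrite (@ge0_integration_by_substitution0 _ f)//.
by apply: eq_integral => t _; rewrite /f mulrN cosN sqrrN.
Qed.

(** Since [2 sin(ut) sin(wt) = cos((u - w)t) - cos((u + w)t)], the product is half the difference of
    the Fejer kernels at [u + w] and [u - w]. The bound [w <= u] keeps both parameters
    nonnegative. *)
Lemma has_integral_sin_sin (u w : R) : 0 <= w <= u ->
  has_integral mu (fun t => sin (u * t) / t * (sin (w * t) / t)) (w * pi).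
Proof.
move=> /andP[w0 wu].
have uw0 : 0 <= u - w by rewrite subr_ge0.
have uw1 : 0 <= u + w by rewrite addr_ge0// (le_trans w0).
have := has_integralZ 2^-1 (has_integralB (has_integral_fejer uw1) (has_integral_fejer uw0)).
rewrite (_ : 2^-1 * _ = w * pi); last by field.
apply: has_integral_ext => t.
by rewrite [(u + w) * t]mulrDl [(u - w) * t]mulrBl cosB cosD -exprVn; move: t^-1 => ?; field.
Qed.

End fejer_kernel.

(** * Sine quotients integrated against their translates *)

Section sine_quotient.
Context {R : realType}.
Notation mu := (@lebesgue_measure R).

Lemma integral_itv0c (f F : R -> R) (u v : R) : 0 < u -> F u - F 0 = v ->
  (forall x : R, is_derive x 1 F (f x)) -> continuous f ->
  (\int[mu]_(x in `[0%R, u]) (f x)%:E = v%:E)%E.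
Proof.
move=> u0 <- dF cf.
have cF : continuous F.
  by move=> x; apply: differentiable_continuous; apply/derivable1_diffP; have [] := dF x.
rewrite (@continuous_FTC2 _ f F 0 u)//.
- exact: continuous_subspaceT.
- split; first by move=> x _; have [] := dF x.
  + exact/cvg_at_right_filter/cF.
  + exact/cvg_at_left_filter/cF.
- by move=> x _; rewrite derive1E; have [_ ->] := dF x.
Qed.

Lemma measurable_dsin (u : R) : measurable_fun setT (fun t : R => sin (u * t) / t).
Proof. by apply: measurable_divr => //; apply: measurable_sinM. Qed.

Lemma mulr_sin_div (u t : R) : t * (sin (u * t) / t) = sin (u * t).
Proof.
have [->|t0] := eqVneq t 0; first by rewrite mulr0 sin0 mul0r.
by rewrite mulrC divfK.
Qed.

End sine_quotient.

Section sine_quotient_shift.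
Context {R : realType}.
Notation mu := (@lebesgue_measure R).
(* [phi u 0 = 0], not [u]: identities with [sinc] hold almost everywhere only. *)
Local Notation phi u t := (sin (u * t) / t).

(** Here [z.1] is the time [t] and [z.2] the frequency [w]. The indicator keeps [w] in the range
    where [has_integral_sin_sin] applies, a range of finite length. *)
Let pairf (u d : R) (z : R * R) : R :=
  phi u z.1 * phi z.2 z.1 * sin (z.2 * d) * \1_(`[0, u]%classic) z.2.

Let mem_0u (u w : R) : (w \in (`[0, u]%classic : set R)) = (0 <= w <= u).
Proof. by rewrite mem_setE in_itv. Qed.

Let measurable_pairf (u d : R) : measurable_fun setT (pairf u d).
Proof.
have mi : measurable_fun setT (\1_(`[0, u]%classic) : R -> R).
  exact: measurable_indic.
apply: measurable_funM; last exact: (measurableT_comp mi).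
apply: measurable_funM; last by apply: measurable_sinM.
apply: measurable_funM; apply: measurable_divr => //; exact: measurable_sinM.
Qed.

(** This dominates a product of sine quotients by squares, whose integrals are known. *)
Lemma normM_le_sqr (a b : R) : `|a * b| <= 2^-1 * (a * a + b * b).
Proof.
rewrite ler_norml; have := sqr_ge0 (a + b); have := sqr_ge0 (a - b).
by rewrite !expr2 => *; apply/andP; split; lra.
Qed.

(** For fixed [w] in [[0, u]], the bound [normM_le_sqr] and [|sin| <= 1] give an integral over [t]
    of at most [(u + w) pi / 2 <= u pi], a constant that is integrable over [[0, u]]. *)
Let integrable_pairf (u d : R) : 0 < u ->
  (mu \x mu)%E.-integrable setT (EFin \o pairf u d).
Proof.
move=> u0.
have mf : measurable_fun setT (EFin \o pairf u d).
  by apply/measurable_EFinP; exact: measurable_pairf.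
apply/integrable21ltyP => //.
have mg : measurable_fun setT (fun w : R => (u * pi * \1_(`[0, u]%classic) w)%:E).
  apply/measurable_EFinP; apply: measurable_funM => //; exact: measurable_indic.
apply: (@le_lt_trans _ _ (\int[mu]_w (u * pi * \1_(`[0, u]%classic) w)%:E)%E).
  apply: ge0_le_integral => //.
  - by move=> w _; exact: integral_ge0.
  - apply: (@measurable_fun_fubini_tonelli_G _ _ _ _ _ mu
      (fun z => `|(EFin \o pairf u d) z|)%E) => //.
    exact: measurableT_comp.
  move=> w _; rewrite /= /pairf/=.
  rewrite indicE mem_0u; case: (boolP (0 <= w <= u)) => [/andP[w0 wu]|_]; last first.
    by rewrite integral0_eq ?mulr0// => t _; rewrite mulr0 normr0.
  have uu : 0 <= u <= u by rewrite lexx ltW.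
  have ww : 0 <= w <= w by rewrite lexx w0.
  have [bi bE] := has_integralZ 2^-1
    (has_integralD (has_integral_sin_sin uu) (has_integral_sin_sin ww)).
  apply: (@le_trans _ _ ((2^-1 * (u * pi + w * pi))%:E)); last first.
    by rewrite lee_fin mulr1; have := pi_ge0 R; nra.
  rewrite -bE; apply: ge0_le_integral => //.
  - apply/measurable_EFinP; apply: measurableT_comp => //.
    apply: measurable_funM => //; apply: measurable_funM => //.
    by apply: measurable_funM; exact: measurable_dsin.
  - exact: measurable_int bi.
  - move=> t _; rewrite lee_fin mulr1 normrM.
    apply: le_trans (normM_le_sqr _ _).
    by rewrite ler_piMr// ler_norml sin_geN1 sin_le1.
under eq_integral do rewrite EFinM.
rewrite integralZl//; last first.
  exact: (@integrable_indic_itv R 0 u true false).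
rewrite integral_indic// setIT/= lebesgue_measure_itv/= lte_fin u0 -EFinB -EFinM.
exact: ltry.
Qed.

Let sin_int (u d : R) : 0 < u -> d != 0 ->
  (\int[mu]_w (w * pi * sin (w * d) * \1_(`[0%R, u]%classic) w)%:E =
  (pi * (sin (u * d) / d ^+ 2 - u * cos (u * d) / d))%:E)%E.
Proof.
move=> u0 d0.
transitivity (\int[mu]_(w in `[0%R, u]) (w * pi * sin (w * d))%:E)%E.
  rewrite [RHS]integral_mkcond; apply: eq_integral => w _.
  by rewrite patchE indicE; case: ifPn; rewrite ?mulr1 ?mulr0.
apply: (@integral_itv0c _ _ (fun w => pi * (sin (w * d) / d ^+ 2 - w * cos (w * d) / d))) => //.
- by rewrite !mul0r sin0 !mul0r subrr mulr0 subr0.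
- move=> w; apply: is_derive_eq.
  by rewrite /GRing.scale/=; field.
- by move=> w; apply: differentiable_continuous; apply/derivable1_diffP.
Qed.

Let pairf_int1 (u d w : R) :
  (\int[mu]_t (pairf u d (t, w))%:E = (w * pi * sin (w * d) * \1_(`[0%R, u]%classic) w)%:E)%E.
Proof.
rewrite /pairf/= indicE mem_0u; case: (boolP (0 <= w <= u)) => [wu|_]; last first.
  by rewrite mulr0 integral0_eq// => t _; rewrite mulr0.
rewrite mulr1 [w * pi * _]mulrC.
have [_ <-] := has_integralZ (sin (w * d)) (has_integral_sin_sin wu).
by apply: eq_integral => t _; rewrite mulr1 mulrC.
Qed.

(** The product [sin(wt) sin(wd)] is half of [cos(w(t - d)) - cos(w(t + d))]. Its primitive in [w]
    divides by [t - d] and [t + d], hence the excluded points. *)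
Let pairf_int2 (u d t : R) : 0 < u -> t != 0 -> t != d -> t != - d ->
  (\int[mu]_w (pairf u d (t, w))%:E =
   (phi u t / t * (2^-1 * (phi u (t - d) - phi u (t + d))))%:E)%E.
Proof.
move=> u0 t0; rewrite -subr_eq0 => td; rewrite -subr_eq0 opprK => td'.
transitivity (\int[mu]_(w in `[0%R, u]) (phi u t * phi w t * sin (w * d))%:E)%E.
  rewrite [RHS]integral_mkcond; apply: eq_integral => w _.
  by rewrite patchE /pairf/= indicE; case: ifPn; rewrite ?mulr1 ?mulr0.
apply: (@integral_itv0c _ _ (fun w => phi u t / t *
    (2^-1 * (sin (w * (t - d)) / (t - d) - sin (w * (t + d)) / (t + d))))) => //.
- by rewrite !mul0r sin0 !mul0r subrr !mulr0 subr0.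
- move=> w; apply: is_derive_eq.
  rewrite /GRing.scale/= [w * (t - d)]mulrBr [w * (t + d)]mulrDr cosB cosD.
  by field; rewrite t0 td td'.
- by move=> w; apply: differentiable_continuous; apply/derivable1_diffP.
Qed.

Lemma has_integral_sin_shift (u d : R) : 0 < u -> d != 0 ->
  has_integral mu (fun t => phi u t * phi u (t + d)) (pi * (sin (u * d) / d)).
Proof.
move=> u0 d0.
have mphi e : measurable_fun setT (fun t : R => phi u (t + e)).
  apply: (measurableT_comp (measurable_dsin u)); exact: measurable_funD.
have mphi0 := measurable_dsin u.
have uu : 0 <= u <= u by rewrite lexx ltW.
have hphi := has_integral_sin_sin uu.
have HL : has_integral mu
    (fun t => phi u t / t * (2^-1 * (phi u (t - d) - phi u (t + d))))
    (pi * (sin (u * d) / d ^+ 2 - u * cos (u * d) / d)).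
  apply: (has_integral_fubini (integrable_pairf d u0) _ _ (pairf_int1 u d) (sin_int u0 d0)).
    apply: (@filterS3 _ (almost_everywhere mu) (ae_filter_ringOfSetsType mu)
      _ _ _ _ _ (ae_neq 0) (ae_neq d) (ae_neq (- d))) => t t0 td td'.
    exact: pairf_int2.
  apply: measurable_funM; first by apply: measurable_divr.
  by apply: measurable_funM => //; apply: measurable_funB; exact: mphi.
(* The remaining terms cancel because [s * phi u s = sin (u * s)] at
   [s = t - d] and [s = t + d]. *)
have He : has_integral mu
    (fun t => 2^-1 * (phi u t * phi u (t - d)) + 2^-1 * (phi u t * phi u (t + d)))
    (d * (pi * (sin (u * d) / d ^+ 2 - u * cos (u * d) / d)) +
     cos (u * d) * (u * pi)).
  apply: has_integral_ext (has_integralD (has_integralZ d HL)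
    (has_integralZ (cos (u * d)) hphi)) => t.
  have [->|t0] := eqVneq t 0; first by rewrite mulr0 sin0 !(mul0r, mulr0) addr0.
  have H1 := mulr_sin_div u (t - d); have H2 := mulr_sin_div u (t + d).
  move: H1 H2; rewrite [u * (t - d)]mulrBr [u * (t + d)]mulrDr sinB sinD.
  set A := _ / (t - d); set B := _ / (t + d) => H1 H2.
  have -> : d * (phi u t / t * (2^-1 * (A - B))) =
      phi u t / t * 2^-1 * (t * A + t * B - (t - d) * A - (t + d) * B) by ring.
  by rewrite H1 H2; field.
(* [He] controls only the sum of two products; integrability of one of them alone comes from
   domination by squares. *)
have Hi : mu.-integrable setT (EFin \o (fun t => phi u t * phi u (t + d))).
  apply: (@le_integrable_fun _ _ _ mu (fun t : R => phi u t * phi u (t + d))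
    (fun t : R => 2^-1 * (phi u t * phi u t + phi u (t + d) * phi u (t + d)))).
  - by apply: measurable_funM; [exact: mphi0|exact: mphi].
  - by move=> t; exact: normM_le_sqr.
  - exact: has_integralZ (has_integralD hphi (has_integral_shift d hphi)).
have Hv := integrable_has_integral Hi; set v := fine _ in Hv.
(* The quotient is even, so reflection shows that the shifts by [d] and [- d] give the same integral
   [v]; the half-sum in [He] then has integral [v]. *)
have Hv' : has_integral mu (fun t => phi u t * phi u (t - d)) v.
  apply: has_integral_ext (has_integral_opp Hv) => t.
  have -> : - t + d = - (t - d) by ring.
  by rewrite !mulrN !sinN !invrN !mulrNN.
have := has_integral_unique He (has_integralD (has_integralZ 2^-1 Hv') (has_integralZ 2^-1 Hv)).
rewrite -mulrDl (_ : 2^-1 + 2^-1 = 1 :> R) ?mul1r; last by field.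
(* The two cosine terms cancel. *)
suff -> : d * (pi * (sin (u * d) / d ^+ 2 - u * cos (u * d) / d)) +
     cos (u * d) * (u * pi) = pi * (sin (u * d) / d) by move=> ->.
by field.
Qed.

End sine_quotient_shift.

(** * The sinc function as a reproducing kernel *)

Section sinc.
Context {R : realType}.
Notation mu := (@lebesgue_measure R).
Local Notation phi u t := (sin (u * t) / t).

Lemma sincE (fc t : R) : t != 0 -> sinc fc t = pi^-1 * phi (pi * fc) t.
Proof.
by move=> t0; rewrite /sinc (negbTE t0) invfM mulrCA.
Qed.

Lemma measurable_sinc (fc : R) : measurable_fun setT (sinc fc).
Proof.
(* The quotient is [0] at [0], so the indicator term restores the value [fc] there. *)
rewrite (_ : sinc fc = fun t => pi^-1 * phi (pi * fc) t + fc * \1_[set 0] t).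
  apply: measurable_funD; apply: measurable_funM => //.
  exact: measurable_dsin.
apply/funext => t; rewrite indicE.
have [->|t0] := eqVneq t 0; first by rewrite /sinc eqxx mem_set// invr0 !mulr0 add0r mulr1.
by rewrite sincE// memNset ?mulr0 ?addr0// => /eqP; rewrite (negbTE t0).
Qed.

(** Off the null set [{a, b}] both factors are multiples of sine quotients. Translation by [a]
    reduces the case [a = b] to [has_integral_sin_sin] with equal frequencies, and the other case to
    a shift by [a - b]. *)
Lemma has_integral_sinc (fc a b : R) : 0 < fc ->
  has_integral mu (fun t => sinc fc (t - a) * sinc fc (t - b)) (sinc fc (a - b)).
Proof.
move=> fc0; have u0 : 0 < pi * fc by rewrite mulr_gt0 ?pi_gt0.
have pi0 : pi != 0 :> R by rewrite gt_eqF ?pi_gt0.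
have msinc e : measurable_fun setT (fun t : R => sinc fc (t - e)).
  apply: (measurableT_comp (measurable_sinc fc)); exact: measurable_funB.
apply: (@has_integral_ae _ _ _ mu (fun t : R =>
    pi^-1 ^+ 2 * (phi (pi * fc) (t - a) * phi (pi * fc) (t - b)))).
- apply: (@filterS2 _ (almost_everywhere mu) (ae_filter_ringOfSetsType mu)
    _ _ _ _ (ae_neq a) (ae_neq b)) => t ta tb.
  by rewrite !sincE ?subr_eq0//; ring.
- by apply: measurable_funM; exact: msinc.
have [->|ab] := eqVneq a b.
  have uu : 0 <= pi * fc <= pi * fc by rewrite lexx ltW.
  have := has_integralZ (pi^-1 ^+ 2) (has_integral_shift (- b) (has_integral_sin_sin uu)).
  rewrite (_ : _ * (pi * fc * pi) = fc); first by rewrite subrr /sinc eqxx.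
  by move: pi pi0 => p p0; field.
have d0 : a - b != 0 by rewrite subr_eq0.
have := has_integralZ (pi^-1 ^+ 2) (has_integral_shift (- a) (has_integral_sin_shift u0 d0)).
rewrite (_ : _ * (pi * _) = sinc fc (a - b)); last first.
  rewrite sincE//; move: (sin _) => ?; move: pi pi0 => p p0.
  by field; rewrite p0 d0.
by apply: has_integral_ext => t; rewrite addrA subrK.
Qed.

End sinc.

(** * The likelihood constraint for an abstract family of kernels with Gram matrix [s] *)

Section gram.
Context {d : measure_display} {T : measurableType d} {R : realType}.
Variables (mu : {measure set T -> \bar R}) (n : nat) (k : 'I_n -> T -> R).
Variables (s : 'M[R]_n) (c : 'cV[R]_n).
Hypothesis n_gt0 : (0 < n)%N.
Hypothesis ks : forall i j, has_integral mu (fun z => k i z * k j z) (s i j).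
Hypothesis cs : blml_feasible s c.

Let r z := 1 / n%:R * \sum_(j < n) c j 0 * k j z.

Lemma blml_reproducing i : has_integral mu (fun z => k i z * r z) (c i 0)^-1.
Proof.
have n0 : n%:R != 0 :> R by rewrite pnatr_eq0 -lt0n.
have := has_integralZ (1 / n%:R) (has_integral_sum (index_enum 'I_n)
  (fun j => has_integralZ (c j 0) (ks i j))).
have [c0 /(_ i)/eqP] := cs; rewrite /rho subr_eq0 => /eqP ->.
rewrite (_ : 1 / n%:R * (n%:R / c i 0) = (c i 0)^-1); last by field; rewrite n0 c0.
apply: has_integral_ext => z; rewrite /r mulrCA; congr (_ * _).
by rewrite mulr_sumr; apply: eq_bigr => j _; rewrite mulrCA.
Qed.

Lemma blml_unit_norm : has_integral mu (fun z => r z * r z) 1.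
Proof.
have n0 : n%:R != 0 :> R by rewrite pnatr_eq0 -lt0n.
have := has_integralZ (1 / n%:R) (has_integral_sum (index_enum 'I_n)
  (fun j => has_integralZ (c j 0) (blml_reproducing j))).
(* Each of the [n] terms is [c_j] times [1 / c_j], and the prefactor is [1 / n]. *)
rewrite (eq_bigr (fun=> 1)); last by move=> j _; rewrite divff//; case: cs.
rewrite sumr_const card_ord -[1 *+ n]/(n%:R) mul1r mulVf//.
apply: has_integral_ext => z; transitivity (n%:R^-1 * ((\sum_(j < n) c j 0 * k j z) * r z)).
  by rewrite mulr_suml; congr (_ * _); apply: eq_bigr => j _; rewrite mulrA.
by rewrite {2}/r mul1r mulrA.
Qed.

End gram.

(** * Kernels and roots in dimensions one and two *)

Lemma sincv_scalar_pt {R : realType} (fc a b : R) :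
  sincv (scalar_pt fc) (scalar_pt a - scalar_pt b) = sinc fc (a - b).
Proof. by rewrite /sincv big_ord1 !mxE. Qed.

Lemma sincv_pair_pt {R : realType} (fc a b a' b' : R) :
  sincv (pair_pt fc fc) (pair_pt a b - pair_pt a' b') =
  sinc fc (a - a') * sinc fc (b - b').
Proof. by rewrite /sincv big_ord_recl big_ord1 !mxE. Qed.

Lemma blml_root_scalar_pt {R : realType} (n : nat) (fc : R) (x : 'I_n -> R) c t :
  blml_root (scalar_pt fc) (fun i => scalar_pt (x i)) c (scalar_pt t) =
  1 / n%:R * \sum_(j < n) c j 0 * sinc fc (t - x j).
Proof.
by congr (_ * _); apply: eq_bigr => j _; rewrite sincv_scalar_pt.
Qed.

Lemma blml_root_pair_pt {R : realType} (n : nat) (fc : R) (x y : 'I_n -> R) c t t' :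
  blml_root (pair_pt fc fc) (fun i => pair_pt (x i) (y i)) c (pair_pt t t') =
  1 / n%:R * \sum_(j < n) c j 0 * (sinc fc (t - x j) * sinc fc (t' - y j)).
Proof.
by congr (_ * _); apply: eq_bigr => j _; rewrite sincv_pair_pt.
Qed.

(** * Hellinger distances from inner products of roots *)

(** The squares of [|r| - |s|] and [r - s] differ only in the cross term, and [|r s| = r s] when the
    signs agree. *)
Lemma hellinger_sqr {R : realType} {d} {T : measurableType d}
    (mu : {measure set T -> \bar R}) (r s : T -> R) :
  (forall z, 0 <= r z * s z) ->
  hellinger mu (fun z => r z ^+ 2) (fun z => s z ^+ 2) = hellinger_roots mu r s.
Proof.
move=> rs; rewrite /hellinger /hellinger_roots; congr (sqrte (_ * _)).
apply: eq_integral => z _; congr EFin; rewrite !sqrtr_sqr !sqrrB !real_normK ?num_real//.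
by rewrite -normrM ger0_norm.
Qed.

(** Expanding the square of the difference of two unit vectors gives half of [2 - 2v], with [v]
    their inner product. *)
Lemma hellinger_rootsE {R : realType} {d} {T : measurableType d}
    (mu : {measure set T -> \bar R}) (r s : T -> R) (v : R) :
  has_integral mu (fun z => r z * r z) 1 ->
  has_integral mu (fun z => s z * s z) 1 ->
  has_integral mu (fun z => r z * s z) v ->
  hellinger_roots mu r s = (Num.sqrt (1 - v))%:E.
Proof.
move=> rr ss rs.
have [_] : has_integral mu (fun z => (r z - s z) ^+ 2) (1 + 1 - 2 * v).
  apply: has_integral_ext (has_integralB (has_integralD rr ss) (has_integralZ 2 rs)) => z.
  by ring.
rewrite /hellinger_roots => ->.
by rewrite -EFinM/=; congr (Num.sqrt _)%:E; field.
Qed.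

(** The coefficient vectors are arbitrary maximizers; the same choice, signs included, enters the
    roots and the sum. *)
Theorem mainTheorem1 (R : realType) (n : nat) (n_gt0 : (0 < n)%N)
    (fc : R) (fc_gt0 : 0 < fc) (x y : 'I_n -> R)
    (cXY cX cY : 'cV[R]_n)
    (hXY : blml_coef (pair_pt fc fc) (fun i => pair_pt (x i) (y i)) cXY)
    (hX : blml_coef (scalar_pt fc) (fun i => scalar_pt (x i)) cX)
    (hY : blml_coef (scalar_pt fc) (fun i => scalar_pt (y i)) cY) :
  let gXY (z : R * R) :=
    blml_root (pair_pt fc fc) (fun i => pair_pt (x i) (y i)) cXY
      (pair_pt z.1 z.2) in
  let gX (a : R) :=
    blml_root (scalar_pt fc) (fun i => scalar_pt (x i)) cX (scalar_pt a) in
  let gY (b : R) :=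
    blml_root (scalar_pt fc) (fun i => scalar_pt (y i)) cY (scalar_pt b) in
  let fXY (z : R * R) :=
    blml_pdf (pair_pt fc fc) (fun i => pair_pt (x i) (y i)) cXY
      (pair_pt z.1 z.2) in
  let fX (a : R) :=
    blml_pdf (scalar_pt fc) (fun i => scalar_pt (x i)) cX (scalar_pt a) in
  let fY (b : R) :=
    blml_pdf (scalar_pt fc) (fun i => scalar_pt (y i)) cY (scalar_pt b) in
  let value : R :=
    Num.sqrt (1 - 1 / n%:R * \sum_(i < n) cXY i 0 / (cX i 0 * cY i 0)) in
  [/\ hellinger_roots lebesgue2 gXY (fun z => gX z.1 * gY z.2) = value%:E,
      (forall a b, 0 <= gXY (a, b) * (gX a * gY b)) ->
        hellinger lebesgue2 fXY (fun z => fX z.1 * fY z.2) = value%:E,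
      blml_argmax
        (\matrix_(i < n, j < n) (sinc fc (x i - x j) * sinc fc (y i - y j)))
        cXY,
      blml_argmax (\matrix_(i < n, j < n) sinc fc (x i - x j)) cX &
      blml_argmax (\matrix_(i < n, j < n) sinc fc (y i - y j)) cY].
Proof.
move=> gXY gX gY fXY fX fY value.
(* The matrices in [blml_coef] are made explicit, so that feasibility can be combined with the
   integrals of sinc products. *)
have aX : blml_argmax (\matrix_(i < n, j < n) sinc fc (x i - x j)) cX.
  suff -> : \matrix_(i < n, j < n) sinc fc (x i - x j) =
    \matrix_(i < n, j < n) sincv (scalar_pt fc) (scalar_pt (x i) - scalar_pt (x j)) by [].
  by apply/matrixP => i j; rewrite !mxE sincv_scalar_pt.
have aY : blml_argmax (\matrix_(i < n, j < n) sinc fc (y i - y j)) cY.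
  suff -> : \matrix_(i < n, j < n) sinc fc (y i - y j) =
    \matrix_(i < n, j < n) sincv (scalar_pt fc) (scalar_pt (y i) - scalar_pt (y j)) by [].
  by apply/matrixP => i j; rewrite !mxE sincv_scalar_pt.
have aXY : blml_argmax
    (\matrix_(i < n, j < n) (sinc fc (x i - x j) * sinc fc (y i - y j))) cXY.
  suff -> : \matrix_(i < n, j < n) (sinc fc (x i - x j) * sinc fc (y i - y j)) =
    \matrix_(i < n, j < n) sincv (pair_pt fc fc)
      (pair_pt (x i) (y i) - pair_pt (x j) (y j)) by [].
  by apply/matrixP => i j; rewrite !mxE sincv_pair_pt.
have gXE t : gX t = 1 / n%:R * \sum_(j < n) cX j 0 * sinc fc (t - x j).
  exact: blml_root_scalar_pt.
have gYE t : gY t = 1 / n%:R * \sum_(j < n) cY j 0 * sinc fc (t - y j).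
  exact: blml_root_scalar_pt.
have gXYE z : gXY z =
    1 / n%:R * \sum_(j < n) cXY j 0 * (sinc fc (z.1 - x j) * sinc fc (z.2 - y j)).
  exact: blml_root_pair_pt.
pose mu := @lebesgue_measure R.
have kX i j : has_integral mu (fun t => sinc fc (t - x i) * sinc fc (t - x j))
    ((\matrix_(i < n, j < n) sinc fc (x i - x j)) i j).
  by rewrite mxE; exact: has_integral_sinc.
have kY i j : has_integral mu (fun t => sinc fc (t - y i) * sinc fc (t - y j))
    ((\matrix_(i < n, j < n) sinc fc (y i - y j)) i j).
  by rewrite mxE; exact: has_integral_sinc.
have kXY i j : has_integral lebesgue2
    (fun z : R * R => (sinc fc (z.1 - x i) * sinc fc (z.2 - y i)) *
                      (sinc fc (z.1 - x j) * sinc fc (z.2 - y j)))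
    ((\matrix_(i < n, j < n) (sinc fc (x i - x j) * sinc fc (y i - y j))) i j).
  rewrite mxE; apply: has_integral_ext (has_integral_prod
    (has_integral_sinc (x i) (x j) fc_gt0) (has_integral_sinc (y i) (y j) fc_gt0)) => z.
  by rewrite mulrACA.
have main : hellinger_roots lebesgue2 gXY (fun z => gX z.1 * gY z.2) = value%:E.
  apply: hellinger_rootsE.
  - apply: has_integral_ext (blml_unit_norm n_gt0 kXY aXY.1) => z.
    by rewrite !gXYE.
  - rewrite -[1]mulr1; apply: has_integral_ext (has_integral_prod
      (blml_unit_norm n_gt0 kX aX.1) (blml_unit_norm n_gt0 kY aY.1)) => z.
    by rewrite mulrACA -gXE -gYE.
  (* The joint kernel [i] splits into marginal kernels, so its inner product with the product of the
     marginal roots is [1 / (cX_i cY_i)]. *)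
  - have := has_integralZ (1 / n%:R) (has_integral_sum (index_enum 'I_n)
      (fun i => has_integralZ (cXY i 0)
        (has_integral_prod (blml_reproducing n_gt0 kX aX.1 i)
                           (blml_reproducing n_gt0 kY aY.1 i)))).
    rewrite (eq_bigr (fun i => cXY i 0 / (cX i 0 * cY i 0))); last first.
      by move=> i _; rewrite invfM.
    apply: has_integral_ext => z; rewrite gXYE -[RHS]mulrA; congr (_ * _).
    rewrite mulr_suml; apply: eq_bigr => i _.
    by rewrite -gXE -gYE mulrACA; exact: mulrA.
(* The product of the marginal estimates is the square of the product of their roots, so [main]
   carries over to nonnegative roots. *)
split => //; move=> pos; rewrite -main -hellinger_sqr; last by case.
congr hellinger; apply/funext => z.
by rewrite exprMn.
Qed.
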